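(* Let $A:\mathbb{R}\to\mathbb{C}^{m\times m}$ be continuous with a full asymptotic expansion $A(\rho)\sim A_0+\rho A_1+\rho^2A_2+\cdots$ as $\rho\to0$. Assume that, for some $\epsilon>0$, the matrix family $A(\rho)$ is uniformly diagonable for all $\rho<\epsilon$ up to and including $\rho=0$, i.e. for $0\le\rho<\epsilon$. Then Assumption (A$_n$) (defined in the context) is satisfied for all $n\in\{0,1,2,\ldots\}$.
   Context: The matrix family $A(\rho)$ is called uniformly diagonable for all $\rho$ in a given parameter set if there exists a family of invertible matrices $T(\rho)$, continuous in $\rho$ on this set, such that $T^{-1}(\rho)A(\rho)T(\rho)$ is diagonal for all $\rho$ in the set and $\sup_\rho\|T(\rho)\|<\infty$. A matrix-valued function $F(\rho)$ has the full asymptotic expansion $F(\rho)\sim\sum_{k\ge0}\rho^kF_k$ as $\rho\to0$ if for every $N$ one has $F(\rho)=\sum_{k=0}^N\rho^kF_k+\mathcal{O}(\rho^{N+1})$. ''Diagonable'' means diagonalisable over $\mathbb{C}$; a diagonaliser of a matrix $X$ is an invertible $T$ with $T^{-1}XT$ diagonal. $[X,Y]=XY-YX$. For an equivalence relation $\sim_\Pi$ on $\{1,\dots,m\}$ (a partition $\Pi$), $\mathrm{b\text{-}diag}_\Pi X$ is the matrix with entries $X_{ij}$ if $i\sim_\Pi j$ and $0$ otherwise; a matrix $X$ is $\Pi$-block-diagonal if $X=\mathrm{b\text{-}diag}_\Pi X$. Multi-step diagonalisation scheme. Step 0. Set $\tilde\Lambda_0=A_0$. If $\tilde\Lambda_0$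 is diagonable, choose a diagonaliser $M_0$ with $M_0^{-1}A_0M_0=\Lambda_0=\mathrm{diag}(\lambda^{[0]}_1,\dots,\lambda^{[0]}_m)$, equal eigenvalues being in consecutive positions. Put $i\sim_{\Pi_0}j$ iff $\lambda_i^{[0]}=\lambda_j^{[0]}$, and $\tilde A^{[0]}(\rho)=M_0^{-1}A(\rho)M_0$. Step $k+1$ ($k\ge0$). Suppose that $\tilde A^{[k]}(\rho)\sim\Lambda_0+\rho\Lambda_1+\cdots+\rho^k\Lambda_k+\rho^{k+1}\tilde A^{[k]}_{k+1}+\cdots$ has been constructed, with diagonal $\Lambda_{k'}=\mathrm{diag}(\lambda_1^{[k']},\dots,\lambda_m^{[k']})$ and with partitions given by $i\sim_{\Pi_\ell}j$ iff $\lambda_i^{[k']}=\lambda_j^{[k']}$ for all $k'\le \ell$ ($\ell\le k$). Let $A^{[k,0]}_{k+1}=\mathrm{b\text{-}diag}_{\Pi_0}\tilde A^{[k]}_{k+1}$ and let $K^{[k]}_0$ solve $[\Lambda_0,K^{[k]}_0]+\tilde A^{[k]}_{k+1}-A^{[k,0]}_{k+1}=0$. For $\ell=1,\dots,k$ let $A^{[k,\ell]}_{k+1}=\mathrm{b\text{-}diag}_{\Pi_\ell}A^{[k,\ell-1]}_{k+1}$ and let $K^{[k]}_\ell$ be a $\Pi_{\ell-1}$-block-diagonal solution of $[\Lambda_\ell,K^{[k]}_\ell]+A^{[k,\ell-1]}_{k+1}-A^{[k,\ell]}_{k+1}=0$. (For definiteness each $K^{[k]}_\ell$ is taken with zero $(i,j)$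 entries whenever $i\sim_{\Pi_\ell}j$.) Set $\tilde\Lambda_{k+1}=A^{[k,k]}_{k+1}$, which is $\Pi_k$-block-diagonal. If $\tilde\Lambda_{k+1}$ is diagonable, choose a $\Pi_k$-block-diagonal diagonaliser $\tilde M_{k+1}$, so that $\tilde M_{k+1}^{-1}\tilde\Lambda_{k+1}\tilde M_{k+1}=\Lambda_{k+1}$ is diagonal with equal entries within each $\Pi_k$-class in consecutive positions. Then, for small $\rho$, $\tilde A^{[k+1]}(\rho)=S(\rho)^{-1}\tilde A^{[k]}(\rho)S(\rho)$ with $S(\rho)=(I+\rho^{k+1}K^{[k]}_0)(I+\rho^{k}K^{[k]}_1)\cdots(I+\rho K^{[k]}_k)\tilde M_{k+1}$, and it has an expansion $\Lambda_0+\cdots+\rho^{k+1}\Lambda_{k+1}+\rho^{k+2}\tilde A^{[k+1]}_{k+2}+\cdots$, so that the scheme continues. The family $A(\rho)$ satisfies Assumption (A$_n$) if the matrices $\tilde\Lambda_k$, $k=0,1,\dots,n$, are all diagonable (with any fixed admissible choices in the scheme). *)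

(* Defs.v *)
From HB Require Import structures.
From mathcomp Require Import all_boot all_order all_algebra.
From mathcomp Require Import complex.
From mathcomp Require Import all_classical all_reals all_analysis.

Set Implicit Arguments.
Unset Strict Implicit.
Unset Printing Implicit Defensive.

Import Order.TTheory GRing.Theory Num.Theory.
Import numFieldNormedType.Exports.

Local Open Scope classical_set_scope.
Local Open Scope ring_scope.
Local Open Scope complex_scope.

(* R[i] seen as a numClosedFieldType, so that it and its matrices get their
   norm and topology from the library's generic instances. *)
Definition Cplx (R : realType) : numClosedFieldType := R[i].

Section Family.
Variables (R : realType) (m : nat).
Local Notation C := (Cplx R).
Implicit Types (A F : R -> 'M[C]_m) (D : set R).

Definition diagonaliser (X T : 'M[C]_m) : Prop :=
  T \in unitmx /\ is_diag_mx (invmx T *m X *m T).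

Definition uniformly_diagonable A D : Prop :=
  exists T : R -> 'M[C]_m,
    [/\ {within D, continuous T},
        forall rho, D rho -> diagonaliser (A rho) (T rho)
      & has_ubound [set `|T rho| | rho in D]].

(* F(rho) ~ sum_k rho^k c_k as rho -> 0, from both sides. *)
Definition has_expansion F (c : nat -> 'M[C]_m) : Prop :=
  forall N : nat,
    (fun rho : R => F rho - \sum_(k < N.+1) (rho%:C : C) ^+ k *: c k)
      =O_ ((0 : R)^') (fun rho : R => (rho%:C : C) ^+ N.+1).

Definition bdiag (P : rel 'I_m) (X : 'M[C]_m) : 'M[C]_m :=
  \matrix_(i, j) if P i j then X i j else 0.

Definition block_diagonal (P : rel 'I_m) (X : 'M[C]_m) : Prop := X = bdiag P X.

Definition mxbracket (X Y : 'M[C]_m) : 'M[C]_m := X *m Y - Y *m X.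

(* L k is the diagonal matrix Lambda_k. *)
Definition partition_rel (L : nat -> 'M[C]_m) (l : nat) : rel 'I_m :=
  fun i j => [forall k : 'I_l.+1, L k i i == L k j j].

Definition consecutive_classes (P : rel 'I_m) : Prop :=
  forall i j l : 'I_m, (i < j < l)%N -> P i l -> P i j.

Fixpoint iter_bdiag (L : nat -> 'M[C]_m) (X : 'M[C]_m) (l : nat) : 'M[C]_m :=
  if l is l'.+1 then bdiag (partition_rel L l) (iter_bdiag L X l')
  else bdiag (partition_rel L 0) X.

End Family.

(* Everything that is chosen or solved for while running the scheme.
   sch_M 0 is M_0 and sch_M k.+1 is \tilde M_{k+1}; sch_L k is Lambda_k;
   sch_K k l is K^{[k]}_l; sch_c k j is the coefficient of rho^j in the
   expansion of \tilde A^{[k]}. *)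
Record scheme (R : realType) (m : nat) := Scheme {
  sch_M : nat -> 'M[Cplx R]_m;
  sch_L : nat -> 'M[Cplx R]_m;
  sch_K : nat -> nat -> 'M[Cplx R]_m;
  sch_c : nat -> nat -> 'M[Cplx R]_m
}.

Section Scheme.
Variables (R : realType) (m : nat).
Local Notation C := (Cplx R).
Variables (A : R -> 'M[C]_m) (a : nat -> 'M[C]_m) (s : scheme R m).

Definition sch_sim (l : nat) : rel 'I_m := partition_rel (sch_L s) l.

(* A^{[k,l]}_{k+1}, meaningful for l <= k. *)
Definition sch_block (k l : nat) : 'M[C]_m :=
  iter_bdiag (sch_L s) (sch_c s k k.+1) l.

Definition sch_tildeL (k : nat) : 'M[C]_m :=
  if k is k'.+1 then sch_block k' k' else a 0%N.

(* The factors stand in the order l = 0, ..., k from left to right. *)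
Definition sch_S (k : nat) (rho : R) : 'M[C]_m :=
  (\big[mulmx/1%:M]_(l < k.+1)
     (1%:M + (rho%:C : C) ^+ (k.+1 - l) *: sch_K s k l)) *m sch_M s k.+1.

(* invmx is total (invmx X = X for singular X); S(rho) is invertible for small
   rho, and only the germ at 0 of \tilde A^{[k]} is ever used. *)
Fixpoint sch_tildeA (k : nat) (rho : R) : 'M[C]_m :=
  if k is k'.+1 then invmx (sch_S k' rho) *m sch_tildeA k' rho *m sch_S k' rho
  else invmx (sch_M s 0) *m A rho *m sch_M s 0.

Definition admissible_K (k : nat) : Prop :=
  [/\ mxbracket (sch_L s 0) (sch_K s k 0) + sch_c s k k.+1 - sch_block k 0 = 0,
      forall l, (l < k)%N ->
        block_diagonal (sch_sim l) (sch_K s k l.+1) /\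
        mxbracket (sch_L s l.+1) (sch_K s k l.+1)
          + sch_block k l - sch_block k l.+1 = 0
    & forall l, (l <= k)%N ->
        forall i j, sch_sim l i j -> sch_K s k l i j = 0].

(* The positions carrying one common value of Lambda_k inside one class of
   Pi_{k-1} (any common value, if k = 0) form one class of Pi_k; hence
   consecutive_classes is the requirement that equal entries be consecutive. *)
Definition admissible_M (k : nat) : Prop :=
  [/\ diagonaliser (sch_tildeL k) (sch_M s k),
      (0 < k)%N -> block_diagonal (sch_sim k.-1) (sch_M s k),
      sch_L s k = invmx (sch_M s k) *m sch_tildeL k *m sch_M s k
    & consecutive_classes (sch_sim k)].

(* Step k of the scheme has been performed: Lambda_k, \tilde A^{[k]} and its
   expansion, hence also \tilde Lambda_{k+1}, have been obtained. *)
Definition scheme_step (k : nat) : Prop :=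
  [/\ (0 < k)%N -> admissible_K k.-1,
      admissible_M k
    & has_expansion (sch_tildeA k) (sch_c s k)].

End Scheme.

(* (A_n): whatever the admissible choices made in the previous steps,
   \tilde Lambda_k is diagonable for k = 0, ..., n. *)
Definition assumptionA (R : realType) (m : nat)
    (A : R -> 'M[Cplx R]_m) (a : nat -> 'M[Cplx R]_m) (n : nat) : Prop :=
  forall (s : scheme R m) (k : nat), (k <= n)%N ->
    (forall j, (j < k)%N -> scheme_step A a s j) ->
    diagonalizable (sch_tildeL a s k).

(* Main.v *)
Require Import Defs.
From HB Require Import structures.
From mathcomp Require Import all_boot all_order all_algebra.
From mathcomp Require Import ring zify.
From mathcomp Require Import complex.
From mathcomp Require Import all_classical all_reals all_analysis.
Import Order.TTheory GRing.Theory Num.Theory.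
Import numFieldNormedType.Exports.
Local Open Scope classical_set_scope.
Local Open Scope ring_scope.

Set Implicit Arguments.
Unset Strict Implicit.
Unset Printing Implicit Defensive.

(* Let D(rho) be the diagonal form of \tilde A^{[k]}(rho) and V(rho) a
   diagonaliser with an invertible limit V0 as rho -> 0+; such a V exists
   because it can be transported from T(rho) through the steps S(rho), which
   converge to invertible matrices.  Up to o(rho^{k+1}) the family is
   E(rho) + rho^{k+1} X with E = sum_{l <= k} rho^l Lambda_l diagonal, so the
   (i, j) entry of \tilde A^{[k]} V = V D reads
     rho^{-(k+1)} (d_j - p_i) V_ij --> (X V0)_ij,     p_i = E_ii.
   If V0_ij <> 0 for i = i0, then rho^{-(k+1)} (d_j - p_i0) has a finite limit
   mu, and for i not Pi_k-equivalent to i0 the gap p_i0 - p_i is of order at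
   least rho^k, which forces V0_ij = 0.  Hence column j of V0 lives on one class
   of Pi_k, where it is an eigenvector of b-diag_{Pi_k} X for mu: the invertible
   matrix V0 diagonalises \tilde Lambda_{k+1}. *)

Lemma cvg_to_eq {T : Type} {U : topologicalType} {F : set_system T}
    {f g : T -> U} {a b : U} :
  g =1 f -> a = b -> f @ F --> a -> g @ F --> b.
Proof. by move=> /funext -> ->. Qed.

(** * Limits of matrix products, determinants and inverses *)

Section Limits.
Context {K : numFieldType} {T : Type} {F : set_system T} {FF : Filter F}.

Lemma cvg_mxP m n (f : T -> 'M[K]_(m, n)) (l : 'M[K]_(m, n)) :
  f @ F --> l <-> forall i j, f x i j @[x --> F] --> l i j.
Proof.
split=> [fl i j | fl]; first exact: cvg_comp fl (coord_continuous (x := l)).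
move=> A [P lP sPA]; apply: (@filterS _ _ _ _ _ sPA).
apply: filter_forall => i; apply: filter_forall => j.
exact: fl (lP i j).
Qed.

Lemma cvg_bigsum I (r : seq I) (P : pred I) (f : I -> T -> K) (l : I -> K) :
  (forall i, P i -> f i x @[x --> F] --> l i) ->
  (\sum_(i <- r | P i) f i x) @[x --> F] --> \sum_(i <- r | P i) l i.
Proof.
move=> fl; elim: r => [|i r IHr].
  by under eq_fun do rewrite big_nil; rewrite big_nil; exact: cvg_cst.
under eq_fun do rewrite big_cons; rewrite big_cons.
by case: ifP => // Pi; apply: cvgD => //; exact: fl.
Qed.

Lemma cvg_bigprod I (r : seq I) (P : pred I) (f : I -> T -> K) (l : I -> K) :
  (forall i, P i -> f i x @[x --> F] --> l i) ->
  (\prod_(i <- r | P i) f i x) @[x --> F] --> \prod_(i <- r | P i) l i.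
Proof.
move=> fl; elim: r => [|i r IHr].
  by under eq_fun do rewrite big_nil; rewrite big_nil; exact: cvg_cst.
under eq_fun do rewrite big_cons; rewrite big_cons.
by case: ifP => // Pi; apply: cvgM => //; exact: fl.
Qed.

Lemma cvg_mulmx m n p (f : T -> 'M[K]_(m, n)) (g : T -> 'M[K]_(n, p))
    (a : 'M[K]_(m, n)) (b : 'M[K]_(n, p)) :
  f @ F --> a -> g @ F --> b -> (f x *m g x) @[x --> F] --> a *m b.
Proof.
move=> /cvg_mxP fa /cvg_mxP gb; apply/cvg_mxP => i j.
under eq_fun do rewrite mxE; rewrite mxE.
by apply: cvg_bigsum => k _; exact: cvgM.
Qed.

Lemma cvg_det n (f : T -> 'M[K]_n) (a : 'M[K]_n) :
  f @ F --> a -> \det (f x) @[x --> F] --> \det a.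
Proof.
move=> /cvg_mxP fa; apply: cvg_bigsum => s _.
by apply: cvgM; [exact: cvg_cst | exact: cvg_bigprod].
Qed.

Lemma near_unitmx n (f : T -> 'M[K]_n) (a : 'M[K]_n) :
  f @ F --> a -> a \in unitmx -> \forall x \near F, f x \in unitmx.
Proof.
move=> fa; rewrite unitmxE unitfE => a0.
apply: filterS (cvgr_neq0 _ (cvg_det fa) a0) => x.
by rewrite unitmxE unitfE.
Qed.

(** The adjugate and the determinant are polynomial in the entries. Since [invmx] is defined by
    cases, the formula [det^-1 *: adj] agrees with it only eventually, once [f x] is invertible. *)
Lemma cvg_invmx n (f : T -> 'M[K]_n) (a : 'M[K]_n) :
  f @ F --> a -> a \in unitmx -> invmx (f x) @[x --> F] --> invmx a.
Proof.
move=> fa ua.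
have adj_cvg : \adj (f x) @[x --> F] --> \adj a.
  apply/cvg_mxP => i j; under eq_fun do rewrite mxE; rewrite mxE.
  apply: cvgM; first exact: cvg_cst.
  apply: cvg_det; apply/cvg_mxP => k l.
  under eq_fun do rewrite !mxE; rewrite !mxE.
  by have /cvg_mxP := fa; apply.
have : (\det (f x))^-1 *: \adj (f x) @[x --> F] --> invmx a.
  rewrite /invmx ua; apply: cvgZ => //; apply: cvgV; last exact: cvg_det.
  by rewrite -unitfE -unitmxE.
apply: cvg_trans; apply: near_eq_cvg.
by apply: filterS (near_unitmx fa ua) => x ux; rewrite /invmx ux.
Qed.

End Limits.

(** * Calculus of o(t^k) and uniqueness of expansions *)

Section Negligible.
Context {K : numFieldType} {T : Type} {F : set_system T} {FF : ProperFilter F}.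
Variable t : T -> K.
Hypotheses (t_cvg0 : t @ F --> 0) (t_neq0 : \forall x \near F, t x != 0).

(* f = o(t^k). *)
Definition negligible (m n k : nat) (f : T -> 'M[K]_(m, n)) : Prop :=
  t x ^- k *: f x @[x --> F] --> (0 : 'M[K]_(m, n)).

Lemma cvg_expr0 k : (0 < k)%N -> t x ^+ k @[x --> F] --> (0 : K).
Proof.
case: k => // k _; elim: k => [|k IHk]; first exact: t_cvg0.
apply: (cvg_to_eq _ _ (cvgM t_cvg0 IHk)) => [x|]; last exact: mulr0.
exact: exprS.
Qed.

Context {m : nat}.
Implicit Types (f g G : T -> 'M[K]_m) (k : nat).

Lemma eq_negligible k f g :
  (\forall x \near F, f x = g x) -> negligible k f -> negligible k g.
Proof.
move=> fg; apply: cvg_trans; apply: near_eq_cvg.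
by apply: filterS fg => x ->.
Qed.

Lemma negligible0 k : negligible k (fun _ => 0 : 'M[K]_m).
Proof.
by rewrite /negligible; under eq_fun do rewrite scaler0; exact: cvg_cst.
Qed.

Lemma negligibleD k f g :
  negligible k f -> negligible k g -> negligible k (fun x => f x + g x).
Proof.
move=> f0 g0; apply: (cvg_to_eq _ _ (cvgD f0 g0)) => [x|].
  exact: scalerDr.
exact: addr0.
Qed.

Lemma negligibleN k f : negligible k f -> negligible k (fun x => - f x).
Proof.
move=> f0; apply: (cvg_to_eq _ _ (cvgN f0)) => [x|]; last exact: oppr0.
exact: scalerN.
Qed.

Lemma negligibleB k f g :
  negligible k f -> negligible k g -> negligible k (fun x => f x - g x).
Proof. by move=> f0 /negligibleN; exact: negligibleD. Qed.

Lemma negligible_sum k I (r : seq I) (P : pred I) (f : I -> T -> 'M[K]_m) :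
  (forall i, P i -> negligible k (f i)) ->
  negligible k (fun x => \sum_(i <- r | P i) f i x).
Proof.
move=> f0; elim: r => [|i r IHr].
  by apply: eq_negligible (negligible0 k); apply: nearW => x; rewrite big_nil.
have [Pi|nPi] := boolP (P i).
  apply: eq_negligible (negligibleD (f0 i Pi) IHr).
  by apply: nearW => x; rewrite big_cons Pi.
apply: eq_negligible IHr; apply: nearW => x.
by rewrite big_cons (negPf nPi).
Qed.

Lemma negligible_mull k G (L : 'M[K]_m) f :
  G @ F --> L -> negligible k f -> negligible k (fun x => G x *m f x).
Proof.
move=> GL f0; apply: (cvg_to_eq _ _ (cvg_mulmx GL f0)) => [x|].
  exact: scalemxAr.
exact: mulmx0.
Qed.

Lemma negligible_mulr k G (L : 'M[K]_m) f :
  G @ F --> L -> negligible k f -> negligible k (fun x => f x *m G x).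
Proof.
move=> GL f0; apply: (cvg_to_eq _ _ (cvg_mulmx f0 GL)) => [x|].
  exact: scalemxAl.
exact: mul0mx.
Qed.

Lemma negligible_expZ k j G (L : 'M[K]_m) :
  (k < j)%N -> G @ F --> L -> negligible k (fun x => t x ^+ j *: G x).
Proof.
move=> kj GL.
have : t x ^+ (j - k) *: G x @[x --> F] --> (0 : 'M[K]_m).
  have tkj : t x ^+ (j - k) @[x --> F] --> 0.
    by apply: cvg_expr0; rewrite subn_gt0.
  by apply: (cvg_to_eq _ _ (cvgZ tkj GL)) => [//|]; exact: scale0r.
apply: cvg_trans; apply: near_eq_cvg.
apply: filterS t_neq0 => x tx.
have -> : t x ^+ j = t x ^+ k * t x ^+ (j - k) by rewrite -exprD subnKC 1?ltnW.
by rewrite scalerA mulKf ?expf_neq0.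
Qed.

Lemma negligible_leq j k f : (j <= k)%N -> negligible k f -> negligible j f.
Proof.
move=> jk f0.
have [->//|jltk] := eqVneq j k.
(* Taken at order 0: the product of [t ^+ (k - j)] with the convergent function [t ^- k *: f] tends
   to 0, and this product is [t ^- j *: f]. *)
have := negligible_expZ (_ : (0 < k - j)%N) f0.
rewrite /negligible subn_gt0 ltn_neqAle jltk jk => /(_ isT).
apply: cvg_trans; apply: near_eq_cvg.
apply: filterS t_neq0 => x tx.
have -> : t x ^+ k = t x ^+ j * t x ^+ (k - j) by rewrite -exprD subnKC.
rewrite expr0 invr1 scale1r scalerA invfM mulrCA divff ?mulr1 //.
exact: expf_neq0.
Qed.

Lemma negligible_expZ_eq0 k (c : 'M[K]_m) :
  negligible k (fun x => t x ^+ k *: c) -> c = 0.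
Proof.
move=> c0; apply: (cvg_unique (@norm_hausdorff K 'M[K]_m) _ c0).
apply: (cvg_trans _ (cvg_cst (F := F) c)); apply: near_eq_cvg.
by apply: filterS t_neq0 => x tx; rewrite scalerA mulVf ?expf_neq0 ?scale1r.
Qed.

(** By strong induction on [j]: the terms below [j] are already zero and those above are o(t^j), so
    the constant [c j] is a limit of functions tending to 0. *)
Lemma expansion_unique k (c : nat -> 'M[K]_m) :
  negligible k (fun x => \sum_(j < k.+1) t x ^+ j *: c j) ->
  forall j, (j <= k)%N -> c j = 0.
Proof.
move=> ck; elim/ltn_ind => j IHj jk; apply: (@negligible_expZ_eq0 j).
pose jo : 'I_k.+1 := Ordinal (jk : (j < k.+1)%N).
have := negligible_leq jk ck.
have tail : negligible j (fun x => \sum_(i < k.+1 | i != jo) t x ^+ i *: c i).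
  apply: negligible_sum => i ij.
  have [ltij|ltji|eqij] := ltngtP i j.
  - rewrite IHj // ?(leq_trans (ltnW ltij)) //.
    apply: eq_negligible (negligible0 j); apply: nearW => x.
    by rewrite scaler0.
  - by apply: negligible_expZ (cvg_cst _).
  - by move: ij; rewrite -val_eqE /= eqij eqxx.
move=> /negligibleB /(_ tail); apply: eq_negligible; near=> x.
by rewrite (bigD1 jo) //= addrK.
Unshelve. all: by end_near. Qed.

End Negligible.

(** * One step of the scheme as an approximate intertwining relation *)

Section Perturbation.
Context {K : numFieldType} {T : Type} {F : set_system T} {FF : ProperFilter F}.
Variable t : T -> K.
Hypotheses (t_cvg0 : t @ F --> 0) (t_neq0 : \forall x \near F, t x != 0).
Context {m : nat}.
Variable L : nat -> 'M[K]_m.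

(** There are [n] terms, so [truncation k.+1] stops at order k. *)
Definition truncation (n : nat) (x : T) : 'M[K]_m :=
  \sum_(j < n) t x ^+ j *: L j.

(** In the bracket of the truncation with [t ^+ (k.+1 - l) *: N], terms below [l] vanish by
    commutation and terms above [l] have order beyond k+1. Only [[L l, N]] survives at order k+1,
    and it accounts for the change from [Y] to [Y']. *)
Lemma step_factor_negligible k l (N Y Y' : 'M[K]_m) :
  (l <= k)%N ->
  (forall j, (j < l)%N -> L j *m N = N *m L j) ->
  L l *m N - N *m L l + Y - Y' = 0 ->
  negligible (F := F) t k.+1 (fun x =>
    (truncation k.+1 x + t x ^+ k.+1 *: Y) *m (1%:M + t x ^+ (k.+1 - l) *: N)
    - (1%:M + t x ^+ (k.+1 - l) *: N)
      *m (truncation k.+1 x + t x ^+ k.+1 *: Y')).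
Proof.
move=> lk comm eqY.
pose lo : 'I_k.+1 := Ordinal (lk : (l < k.+1)%N).
pose rest x := \sum_(j < k.+1 | j != lo)
  t x ^+ (k.+1 - l + j) *: (L j *m N - N *m L j).
have rest0 : negligible (F := F) t k.+1 rest.
  apply: negligible_sum => j jl.
  have [ltjl|ltlj|eqjl] := ltngtP j l.
  - apply: eq_negligible (negligible0 t k.+1); apply: nearW => x.
    by rewrite comm // subrr scaler0.
  - by apply: (negligible_expZ t_cvg0 t_neq0 _ (cvg_cst _)); lia.
  - by move: jl; rewrite -val_eqE /= eqjl eqxx.
have rest'0 : negligible (F := F) t k.+1
    (fun x => t x ^+ (k.+1 + (k.+1 - l)) *: (Y *m N - N *m Y')).
  by apply: (negligible_expZ t_cvg0 t_neq0 _ (cvg_cst _)); lia.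
apply: eq_negligible (negligibleD rest0 rest'0); apply: nearW => x.
have comE : t x ^+ (k.+1 - l)
      *: (truncation k.+1 x *m N - N *m truncation k.+1 x)
    = t x ^+ k.+1 *: (Y' - Y) + rest x.
  have -> : Y' - Y = L l *m N - N *m L l.
    by apply/eqP; rewrite eq_sym -subr_eq0 opprB addrA; apply/eqP.
  rewrite mulmx_suml mulmx_sumr -sumrB scaler_sumr (bigD1 lo) //=.
  congr (_ + _).
    by rewrite -scalemxAl -scalemxAr -scalerBr scalerA -exprD subnK // leqW.
  apply: eq_bigr => j _.
  by rewrite -scalemxAl -scalemxAr -scalerBr scalerA -exprD.
(* Trading [rest] for the bracket of the whole truncation leaves an identity that can be checked
   entry by entry. *)
rewrite exprD -[rest x](addKr (t x ^+ k.+1 *: (Y' - Y))) -comE.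
rewrite !mulmxDl !mulmxDr !mulmx1 !mul1mx -!scalemxAl -!scalemxAr.
by apply/matrixP => i j; rewrite [LHS]mxE ![in RHS]mxE; rewrite ?mxE; ring.
Qed.


(* mulmx is not declared as a Monoid.law, but it is the multiplication of the
   ring 'M_m. *)
Lemma bigmulmx_recr n (f : nat -> 'M[K]_m) :
  \big[mulmx/1%:M]_(l < n.+1) f l = \big[mulmx/1%:M]_(l < n) f l *m f n.
Proof.
exact: (@big_ord_recr _ _ (@GRing.mul 'M[K]_m) n (fun l : 'I_n.+1 => f l)).
Qed.

Definition step_factor (N : nat -> 'M[K]_m) k x l : 'M[K]_m :=
  1%:M + t x ^+ (k.+1 - l) *: N l.

(** The bound on [n] keeps every exponent [k.+1 - l] positive, so each factor tends to the
    identity. *)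
Lemma cvg_step_factors N k n : (n <= k.+1)%N ->
  (\big[mulmx/1%:M]_(l < n) step_factor N k x l) @[x --> F]
    --> (1%:M : 'M[K]_m).
Proof.
elim: n => [_|n IHn nk].
  apply: (cvg_to_eq _ erefl (cvg_cst (1%:M : 'M[K]_m))) => x.
  by rewrite big_ord0.
have factor1 : step_factor N k x n @[x --> F] --> (1%:M : 'M[K]_m).
  have tn0 : t x ^+ (k.+1 - n) @[x --> F] --> (0 : K).
    by apply: cvg_expr0 => //; rewrite subn_gt0.
  apply: (cvg_to_eq _ _
    (cvgD (cvg_cst (1%:M : 'M[K]_m)) (cvgZ tn0 (cvg_cst (N n))))) => [//|].
  by rewrite scale0r addr0.
apply: (cvg_to_eq _ _ (cvg_mulmx (IHn (ltnW nk)) factor1)) => [x|].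
  by rewrite bigmulmx_recr.
exact: mulmx1.
Qed.

(** The one-factor relations telescope: factor [l] replaces [Y l] by [Y l.+1], and the errors remain
    negligible because they are multiplied by convergent products. *)
Lemma step_factors_negligible k n (N Y : nat -> 'M[K]_m) :
  (n <= k.+1)%N ->
  (forall l j, (l <= k)%N -> (j < l)%N -> L j *m N l = N l *m L j) ->
  (forall l, (l <= k)%N -> L l *m N l - N l *m L l + Y l - Y l.+1 = 0) ->
  negligible (F := F) t k.+1 (fun x =>
    (truncation k.+1 x + t x ^+ k.+1 *: Y 0%N)
      *m \big[mulmx/1%:M]_(l < n) step_factor N k x l
    - \big[mulmx/1%:M]_(l < n) step_factor N k x l
      *m (truncation k.+1 x + t x ^+ k.+1 *: Y n)).
Proof.
move=> + comm eqY; elim: n => [_|n IHn nk].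
  apply: eq_negligible (negligible0 t k.+1); apply: nearW => x.
  by rewrite big_ord0 mulmx1 mul1mx subrr.
have factor_n :=
  step_factor_negligible (k := k) nk (fun j => comm n j nk) (eqY n nk).
have cvg_n := @cvg_step_factors N k n (ltnW nk).
have factor1 : step_factor N k x n @[x --> F] --> (1%:M + 0 *: N n : 'M[K]_m).
  apply: cvgD; first exact: cvg_cst.
  apply: cvgZ; last exact: cvg_cst.
  by apply: cvg_expr0 => //; rewrite subn_gt0.
apply: eq_negligible (negligibleD (negligible_mulr factor1 (IHn (ltnW nk)))
  (negligible_mull cvg_n factor_n)).
apply: nearW => x; rewrite bigmulmx_recr mulmxBl mulmxBr !mulmxA.
by rewrite -/(step_factor N k x n) addrA subrK.
Qed.

Definition step_matrix (N : nat -> 'M[K]_m) k (M : 'M[K]_m) x : 'M[K]_m :=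
  \big[mulmx/1%:M]_(l < k.+1) step_factor N k x l *m M.

Lemma cvg_step_matrix N k M : step_matrix N k M @ F --> M.
Proof.
apply: (cvg_to_eq _ _
  (cvg_mulmx (@cvg_step_factors N k k.+1 (leqnn _)) (cvg_cst M))) => [//|].
exact: mul1mx.
Qed.

Lemma step_negligible k (N Y : nat -> 'M[K]_m) (M : 'M[K]_m)
    (B : T -> 'M[K]_m) :
  (forall l j, (l <= k)%N -> (j < l)%N -> L j *m N l = N l *m L j) ->
  (forall l, (l <= k)%N -> L l *m N l - N l *m L l + Y l - Y l.+1 = 0) ->
  M \in unitmx -> (forall j, (j <= k)%N -> L j *m M = M *m L j) ->
  Y k.+1 *m M = M *m L k.+1 ->
  negligible (F := F) t k.+1 (fun x =>
    B x - (truncation k.+1 x + t x ^+ k.+1 *: Y 0%N)) ->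
  negligible (F := F) t k.+1 (fun x =>
    invmx (step_matrix N k M x) *m B x *m step_matrix N k M x
    - truncation k.+2 x).
Proof.
move=> comm eqY uM commM eqM B0.
have cvgS := @cvg_step_matrix N k M.
have E0 := step_factors_negligible (leqnn k.+1) comm eqY.
apply: eq_negligible (negligible_mull (cvg_invmx cvgS uM)
  (negligibleD (negligible_mulr cvgS B0) (negligible_mulr (cvg_cst M) E0))).
apply: filterS (near_unitmx cvgS uM) => x uS.
(* With S the step matrix, the truncation is written as S^-1 S times itself; only the intertwining
   error of S remains, multiplied by a convergent inverse. *)
rewrite -[truncation k.+2 x](mulKmx uS) -mulmxA -mulmxBr; congr (_ *m _).
rewrite !mulmxBl -!mulmxA.
rewrite -/(step_matrix N k M x) addrA subrK; congr (_ - _).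
congr (_ *m _).
rewrite /truncation [in RHS]big_ord_recr /= mulmxDl mulmxDr.
rewrite -scalemxAl eqM scalemxAr; congr (_ + _).
rewrite mulmx_suml mulmx_sumr; apply: eq_bigr => j _.
by rewrite -scalemxAl -scalemxAr commM ?leq_ord.
Qed.

(** * Limits of the columns of a diagonaliser *)

Lemma cvg_diagonalised_column n (B V : T -> 'M[K]_m) (X V0 : 'M[K]_m)
    (i j : 'I_m) :
  (forall l, (l <= n)%N -> is_diag_mx (L l)) ->
  negligible (F := F) t n.+1 (fun x =>
    B x - (truncation n.+1 x + t x ^+ n.+1 *: X)) ->
  V @ F --> V0 ->
  (\forall x \near F,
    V x \in unitmx /\ is_diag_mx (invmx (V x) *m B x *m V x)) ->
  t x ^- n.+1 * ((invmx (V x) *m B x *m V x) j j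
                 - \sum_(l < n.+1) t x ^+ l * L l i i) * V x i j
    @[x --> F] --> (X *m V0) i j.
Proof.
move=> diagL B0 VV0 diagV.
have BX : t x ^- n.+1 *: (B x - truncation n.+1 x) @[x --> F] --> X.
  have BX0 : t x ^- n.+1 *: (B x - (truncation n.+1 x + t x ^+ n.+1 *: X)) + X
      @[x --> F] --> X.
    exact: (cvg_to_eq _ (add0r X) (cvgD B0 (cvg_cst X))).
  apply: cvg_trans BX0; apply: near_eq_cvg.
  apply: filterS t_neq0 => x tx.
  by rewrite opprD addrA scalerBr scalerA mulVf ?expf_neq0 // scale1r subrK.
have /cvg_mxP/(_ i j) : t x ^- n.+1 *: (B x - truncation n.+1 x) *m V x
    @[x --> F] --> X *m V0 by exact: cvg_mulmx.
apply: cvg_trans; apply: near_eq_cvg.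
apply: filterS diagV => x [uV /is_diag_mxP dV].
(* Since B V = V D, and both D and the truncation E are diagonal, the entry of (B - E) V is (D_jj -
   E_ii) V_ij. *)
rewrite -scalemxAl mxE -mulrA; congr (_ * _).
rewrite mulmxBl mxE [X in _ + X]mxE.
rewrite mulrBl; congr (_ - _).
  have -> : B x *m V x = V x *m (invmx (V x) *m B x *m V x).
    by rewrite -mulmxA mulKVmx.
  move: dV; set D := invmx (V x) *m B x *m V x => dV.
  rewrite mxE (bigD1 j) //= big1 ?addr0; first exact: mulrC.
  by move=> k kj; rewrite dV ?mulr0.
rewrite mxE (bigD1 i) //= big1 ?addr0 => [|k ki].
  by rewrite summxE; congr (_ * _); apply: eq_bigr => l _; rewrite mxE.
rewrite summxE big1 ?mul0r // => l _.
have /is_diag_mxP dL := diagL l (ltn_ord l).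
by rewrite mxE dL ?mulr0 // eq_sym.
Qed.

(** After division by t^s the terms below [s] are zero, term [s] is constant and the later ones tend
    to 0. *)
Lemma cvg_lowest_term n s (d : nat -> K) : (s <= n)%N ->
  (forall l, (l < s)%N -> d l = 0) ->
  t x ^- s * (\sum_(l < n.+1) t x ^+ l * d l) @[x --> F] --> d s.
Proof.
move=> sn d0.
have -> : d s = \sum_(l < n.+1) (if l == s :> nat then d s else 0).
  by rewrite -big_mkcond /= (big_pred1 (Ordinal (sn : (s < n.+1)%N))).
have lim : \sum_(l < n.+1) (if (l < s)%N then 0 else t x ^+ (l - s) * d l)
    @[x --> F] --> \sum_(l < n.+1) (if l == s :> nat then d s else 0).
  apply: cvg_bigsum => l _; have [ls|sl|->] := ltngtP l s.
  - exact: cvg_cst.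
  - apply: (cvg_to_eq _ (mul0r (d l)) (cvgM _ (cvg_cst (d l)))) => [//|].
    by apply: cvg_expr0; rewrite ?subn_gt0.
  - apply: (cvg_to_eq _ erefl (cvg_cst (d s))) => x.
    by rewrite subnn mul1r.
apply: cvg_trans lim; apply: near_eq_cvg.
apply: filterS t_neq0 => x tx.
rewrite mulr_sumr; apply: eq_bigr => l _; case: ltnP => [ls|sl].
  by rewrite d0 // !mulr0.
have -> : t x ^+ l = t x ^+ s * t x ^+ (l - s) by rewrite -exprD subnKC.
by rewrite -mulrA mulKf ?expf_neq0.
Qed.

Lemma diagonalised_column_eigenvector n (B V : T -> 'M[K]_m)
    (X V0 : 'M[K]_m) (j : 'I_m) :
  let P i k := [forall l : 'I_n.+1, L l i i == L l k k] in
  (forall l, (l <= n)%N -> is_diag_mx (L l)) ->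
  negligible (F := F) t n.+1 (fun x =>
    B x - (truncation n.+1 x + t x ^+ n.+1 *: X)) ->
  V @ F --> V0 -> V0 \in unitmx ->
  (\forall x \near F,
    V x \in unitmx /\ is_diag_mx (invmx (V x) *m B x *m V x)) ->
  exists mu, forall i,
    \sum_k (if P i k then X i k else 0) * V0 k j = mu * V0 i j.
Proof.
move=> P diagL B0 VV0 uV0 diagV.
(* A zero column j would make the entry (j, j) of [invmx V0 *m V0] vanish. *)
have [i0 V0i0] : exists i0, V0 i0 j != 0.
  apply/existsP; apply: contraT; rewrite negb_exists => /forallP V0j.
  have /matrixP/(_ j j) := mulVmx uV0; rewrite !mxE eqxx => /eqP.
  rewrite big1 => [|k _]; first by rewrite eq_sym oner_eq0.
  by have := V0j k; rewrite negbK => /eqP ->; rewrite mulr0.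
pose q i x := t x ^- n.+1 * ((invmx (V x) *m B x *m V x) j j
                - \sum_(l < n.+1) t x ^+ l * L l i i).
have qV i : q i x * V x i j @[x --> F] --> (X *m V0) i j.
  exact: cvg_diagonalised_column.
have Vij i : V x i j @[x --> F] --> V0 i j by have /cvg_mxP := VV0; apply.
have hK := @norm_hausdorff K K^o.
pose mu := (X *m V0) i0 j / V0 i0 j.
have q_mu : q i0 x @[x --> F] --> mu.
  have : (q i0 x * V x i0 j) / V x i0 j @[x --> F] --> mu.
    by apply: cvgM => //; exact: cvgV.
  apply: cvg_trans; apply: near_eq_cvg.
  by apply: filterS (cvgr_neq0 _ (Vij i0) V0i0) => x Vx; rewrite mulfK.
(* Positions in one class have the same diagonal entries in the truncation, so [q i] and [q i0]
   coincide. *)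
have same i : P i0 i -> (X *m V0) i j = mu * V0 i j.
  move=> /forallP Pi; apply: (cvg_unique hK (qV i)).
  apply: (cvg_to_eq _ erefl (cvgM q_mu (Vij i))) => x /=; congr (_ * _).
  rewrite /q; congr (_ * (_ - _)); apply: eq_bigr => l _.
  by rewrite (eqP (Pi l)).
have diff i : ~~ P i0 i -> V0 i j = 0.
  rewrite negb_forall => /existsP[l1 l1P].
  pose d l := L l i0 i0 - L l i i.
  have exd : exists l, (l <= n)%N && (d l != 0).
    by exists l1; rewrite leq_ord subr_eq0.
  (* Here [s] is the lowest order separating [i] from [i0]; [s <= n] makes the exponent [n.+1 - s]
     below positive. *)
  case: (ex_minnP exd) => s /andP[sn ds] smin.
  have d0 l : (l < s)%N -> d l = 0.
    move=> ls; have ln := ltnW (leq_trans ls sn).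
    apply/eqP; apply: contraTT ls => dl.
    by rewrite -leqNgt; apply: smin; rewrite dl andbT.
  have tns : t x ^+ (n.+1 - s) @[x --> F] --> (0 : K).
    by apply: cvg_expr0; rewrite // subn_gt0.
  (* The difference [q i - q i0] is t^-(n+1) times a gap of lowest term t^s d_s, and [q i0]
     converges. As [q i * V i j] converges too, the same scaling sends it to 0, so [d s * V0 i j] is
     0. *)
  have lim1 : t x ^+ (n.+1 - s) * q i x @[x --> F] --> d s.
    have lim : t x ^+ (n.+1 - s) * q i0 x
        + t x ^- s * (\sum_(l < n.+1) t x ^+ l * d l)
        @[x --> F] --> 0 * mu + d s.
      by apply: cvgD; [exact: cvgM | exact: cvg_lowest_term].
    rewrite mul0r add0r in lim; apply: cvg_trans lim; apply: near_eq_cvg.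
    apply: filterS t_neq0 => x tx.
    have -> : t x ^- s = t x ^+ (n.+1 - s) * t x ^- n.+1.
      have {2}-> : n.+1 = (n.+1 - s + s)%N by rewrite subnK // leqW.
      by rewrite exprD invfM mulVKf ?expf_neq0.
    rewrite -mulrA -mulrDr; congr (_ * _); rewrite /q -mulrDr; congr (_ * _).
    rewrite -addrA; congr (_ + _); rewrite addrC -sumrB -sumrN.
    by apply: eq_bigr => l _; rewrite mulrBr addrAC subrr add0r.
  have lim2 : t x ^+ (n.+1 - s) * q i x * V x i j @[x --> F] --> (0 : K).
    apply: (cvg_to_eq _ (mul0r ((X *m V0) i j)) (cvgM tns (qV i))) => x.
    exact: esym (mulrA _ _ _).
  have : d s * V0 i j = 0 by apply: (cvg_unique hK (cvgM lim1 (Vij i)) lim2).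
  by move/eqP; rewrite mulf_eq0 (negPf ds) => /eqP.
have P_trans i k : P i0 i -> P i k = P i0 k.
  by move=> /forallP Pi; apply: eq_forallb => l; rewrite (eqP (Pi l)).
(* On the class of [i0] the masked sum is the full row sum, since [V0 k j] vanishes elsewhere. Off
   it, the class of [i] misses that of [i0], and both sides are 0. *)
exists mu => i; have [Pi|nPi] := boolP (P i0 i).
  rewrite -same // mxE; apply: eq_bigr => k _; rewrite P_trans //.
  by case: ifPn => // nPk; rewrite diff // !mulr0.
rewrite diff // mulr0 big1 // => k _; case: ifPn; rewrite ?mul0r //.
move=> /forallP Pik; rewrite diff ?mulr0 //; apply: contra nPi => /forallP Pk.
by apply/forallP => l; rewrite (eqP (Pik l)).
Qed.

Lemma block_part_diagonalised n (B V : T -> 'M[K]_m) (X V0 : 'M[K]_m) :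
  (forall l, (l <= n)%N -> is_diag_mx (L l)) ->
  negligible (F := F) t n.+1 (fun x =>
    B x - (truncation n.+1 x + t x ^+ n.+1 *: X)) ->
  V @ F --> V0 -> V0 \in unitmx ->
  (\forall x \near F,
    V x \in unitmx /\ is_diag_mx (invmx (V x) *m B x *m V x)) ->
  is_diag_mx (invmx V0
    *m (\matrix_(i, k) if [forall l : 'I_n.+1, L l i i == L l k k]
                       then X i k else 0)
    *m V0).
Proof.
move=> diagL B0 VV0 uV0 diagV; set Y := matrix_of_fun _ _.
have /choice[mu muP] j :=
  @diagonalised_column_eigenvector n B V X V0 j diagL B0 VV0 uV0 diagV.
have -> : invmx V0 *m Y *m V0 = diag_mx (\row_j mu j).
  rewrite -mulmxA; apply: (canLR (mulKmx uV0)); apply/matrixP => i j.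
  rewrite mul_mx_diag !mxE mulrC -muP.
  by apply: eq_bigr => k _; rewrite mxE.
exact: diag_mx_is_diag.
Qed.

(** Identifies the leading coefficient of a continuous family with its value at 0. *)
Lemma leading_term_limit (f : T -> 'M[K]_m) (l : 'M[K]_m) :
  negligible (F := F) t 0 (fun x => f x - truncation 1 x) ->
  f @ F --> l -> L 0%N = l.
Proof.
move=> f0 fl.
apply: (cvg_unique (@norm_hausdorff K 'M[K]_m) (cvg_cst (F := F) (L 0%N))).
have lim : f x - t x ^- 0 *: (f x - truncation 1 x) @[x --> F] --> l - 0.
  exact: cvgB.
apply: (cvg_to_eq _ (subr0 l) lim) => x.
by rewrite /truncation big_ord1 expr0 invr1 !scale1r subKr.
Qed.

End Perturbation.

Lemma conj_invmx (K : fieldType) m (S X V : 'M[K]_m) :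
  S \in unitmx -> V \in unitmx ->
  invmx (invmx S *m V) *m (invmx S *m X *m S) *m (invmx S *m V)
  = invmx V *m X *m V.
Proof.
move=> uS uV; have uSV : invmx S *m V \in unitmx.
  by rewrite unitmx_mul unitmx_inv uS.
have -> : invmx (invmx S *m V) = invmx V *m S.
  have eq1 : (invmx S *m V) *m (invmx V *m S) = 1%:M.
    by rewrite mulmxA mulmxK // mulVmx.
  by rewrite -[LHS]mulmx1 -eq1 mulKmx.
by rewrite -!mulmxA !mulKVmx // !mulmxA.
Qed.

(** * Expansions and diagonalisers along the scheme *)

Section Scheme.
Context {R : realType} {m : nat}.
Local Notation C := (Cplx R).
Implicit Types (G : R -> 'M[C]_m) (c L : nat -> 'M[C]_m) (X N S V : 'M[C]_m).

Definition cparam (rho : R) : C := (rho%:C)%C.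

(** The expansion is two-sided while diagonalisers are given only for rho >= 0, so all limits are
    taken from the right. *)
Lemma near_dnbhs_at_right (P : R -> Prop) :
  (\forall x \near (0 : R)^', P x) -> \forall x \near (0 : R)^'+, P x.
Proof.
rewrite !near_withinE; apply: filterS => x Px x0; apply: Px.
by rewrite gt_eqF.
Qed.

Lemma cvg_cparam : cparam @ (0 : R)^'+ --> (0 : C).
Proof.
apply/cvgr0Pnorm_lt => e e0.
(* In the order of the complex field a positive [e] is real, so its real part can serve as a
   radius. *)
have eR : e = (complex.Re e)%:C%C by rewrite RRe_real // gtr0_real.
have re0 : 0 < complex.Re e by rewrite -ltcR -eR.
apply: filterS2 (nbhs_right_gt 0) (nbhs_right_lt re0) => x x0 xe.
by rewrite /cparam ger0_norm ?ler0c ?ltW // eR ltcR.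
Qed.

Lemma near_cparam_neq0 : \forall x \near (0 : R)^'+, cparam x != 0.
Proof.
apply: filterS (nbhs_right_gt 0) => x x0.
by rewrite /cparam; apply/eqP => -[] /eqP; rewrite gt_eqF.
Qed.

Lemma expansion_negligible G c n : has_expansion G c ->
  negligible (F := (0 : R)^'+) cparam n
    (fun x => G x - truncation cparam c n.+1 x).
Proof.
move=> /(_ n)/eqO_exP[k k0 /near_dnbhs_at_right Gk].
apply/cvgr0Pnorm_lt => e e0.
(* The error is at most k |rho|^(n+1); after division by |rho|^n it is below [e] as soon as |rho| <
   e / k. *)
apply: filterS3 Gk (cvgr0_norm_lt _ cvg_cparam _ (divr_gt0 e0 k0))
  near_cparam_neq0 => x Gx tx t0.
rewrite normrZ; apply: le_lt_trans (ler_wpM2l (normr_ge0 _) Gx) _.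
rewrite mulrCA -normrM exprSr mulKf ?expf_neq0 //.
by rewrite mulrC -ltr_pdivlMr.
Qed.

(** Pi_{l+1} refines Pi_l and absorbs the coarser extraction, so the iterated block parts of the
    scheme reduce to a single one. *)
Lemma bdiag_partition_rel_succ L l X :
  bdiag (partition_rel L l.+1) (bdiag (partition_rel L l) X)
  = bdiag (partition_rel L l.+1) X.
Proof.
apply/matrixP => i j; rewrite !mxE.
case: ifPn => // /forallP Lij; case: ifPn => // /forallPn[k].
by have := Lij (widen_ord (leqnSn l.+1) k); move=> /= ->.
Qed.

Lemma iter_bdiagE L X l : iter_bdiag L X l = bdiag (partition_rel L l) X.
Proof.
by elim: l => //= l ->; exact: bdiag_partition_rel_succ.
Qed.

(** For [j <= l] the diagonal matrix [L j] is scalar on every class of Pi_l. *)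
Lemma block_diagonal_comm L l j N :
  is_diag_mx (L j) -> (j <= l)%N -> block_diagonal (partition_rel L l) N ->
  L j *m N = N *m L j.
Proof.
move=> /diag_mxP[d Ld] jl ->; apply/matrixP => i k.
rewrite Ld mul_diag_mx mul_mx_diag !mxE.
case: ifPn => [/forallP Lik|]; last by rewrite mulr0 mul0r.
have := Lik (Ordinal (jl : (j < l.+1)%N)).
by rewrite /= Ld !mxE !eqxx !mulr1n mulrC => /eqP ->.
Qed.

Lemma diagonaliser_conj S X V : S \in unitmx -> diagonaliser X V ->
  diagonaliser (invmx S *m X *m S) (invmx S *m V).
Proof.
move=> uS [uV dV]; split; last by rewrite conj_invmx.
by rewrite unitmx_mul unitmx_inv uS.
Qed.

Section Run.
Variables (A : R -> 'M[C]_m) (a : nat -> 'M[C]_m) (s : scheme R m).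

Lemma scheme_step_unit k : scheme_step A a s k -> sch_M s k \in unitmx.
Proof. by case=> _ [[]]. Qed.

Lemma scheme_step_diag k : scheme_step A a s k -> is_diag_mx (sch_L s k).
Proof. by case=> _ [[_ diagM] _ ->]. Qed.

(** Uniqueness identifies the recorded coefficients of order at most k with the Lambda_j, after
    which the recorded expansion can be read one order further. *)
Lemma next_expansion k :
  scheme_step A a s k ->
  negligible (F := (0 : R)^'+) cparam k
    (fun x => sch_tildeA A s k x - truncation cparam (sch_L s) k.+1 x) ->
  negligible (F := (0 : R)^'+) cparam k.+1 (fun x => sch_tildeA A s k x
    - (truncation cparam (sch_L s) k.+1 x
       + cparam x ^+ k.+1 *: sch_c s k k.+1)).
Proof.
move=> [_ _ expk] Lk.
have ck : forall j, (j <= k)%N -> sch_c s k j - sch_L s j = 0.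
  apply: (expansion_unique cvg_cparam near_cparam_neq0).
  apply: eq_negligible (negligibleB Lk (expansion_negligible k expk)).
  apply: nearW => x; rewrite opprB addrCA addrAC subrr sub0r /truncation -sumrB.
  by apply: eq_bigr => j _; rewrite scalerBr.
apply: eq_negligible (expansion_negligible k.+1 expk); apply: nearW => x.
rewrite /truncation big_ord_recr /=; congr (_ - (_ + _)).
apply: eq_bigr => j _; congr (_ *: _).
by apply/eqP; rewrite -subr_eq0 ck ?leq_ord.
Qed.

Hypothesis expA : has_expansion A a.

Lemma scheme_expansion k :
  (forall j, (j <= k)%N -> scheme_step A a s j) ->
  negligible (F := (0 : R)^'+) cparam k
    (fun x => sch_tildeA A s k x - truncation cparam (sch_L s) k.+1 x).
Proof.
elim: k => [|k IHk] steps.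
  have [_ [_ _ L0 _] _] := steps 0%N (leqnn _).
  apply: eq_negligible (negligible_mulr (cvg_cst (sch_M s 0))
    (negligible_mull (cvg_cst (invmx (sch_M s 0)))
      (expansion_negligible 0 expA))).
  apply: nearW => x; rewrite /truncation !big_ord1 expr0 !scale1r L0.
  by rewrite mulmxBr mulmxBl.
have stepsk j : (j <= k)%N -> scheme_step A a s j.
  by move=> jk; apply: steps; rewrite leqW.
have [/(_ isT)[K0 Ksucc _] [[uM _] /(_ isT) blockM LM _] _] :=
  steps k.+1 (leqnn _).
have diagL j : (j <= k)%N -> is_diag_mx (sch_L s j).
  by move=> jk; apply: scheme_step_diag (stepsk j jk).
(* The shift by one gives the equation for K_0 and those for the later K_l the same form, from [Y l]
   to [Y l.+1]. *)
pose Y l := if l is l'.+1 then sch_block s k l' else sch_c s k k.+1.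
apply: (step_negligible (Y := Y) cvg_cparam near_cparam_neq0) => //.
- case=> // l j lk jl; have [blockK _] := Ksucc l lk.
  apply: block_diagonal_comm blockK => //; apply: diagL.
  exact: leq_trans (jl : (j <= l)%N) (ltnW lk).
- by case=> [|l] lk; [exact: K0 | have [] := Ksucc l lk].
- by move=> j jk; apply: block_diagonal_comm blockM => //; exact: diagL.
- by rewrite LM -mulmxA mulKVmx.
- exact: next_expansion (stepsk k (leqnn _)) (IHk stepsk).
Qed.

Lemma scheme_diagonaliser k (V : R -> 'M[C]_m) (V0 : 'M[C]_m) :
  V @ (0 : R)^'+ --> V0 -> V0 \in unitmx ->
  (\forall x \near (0 : R)^'+, diagonaliser (A x) (V x)) ->
  (forall j, (j <= k)%N -> scheme_step A a s j) ->
  exists (W : R -> 'M[C]_m) (W0 : 'M[C]_m),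
    [/\ W @ (0 : R)^'+ --> W0, W0 \in unitmx
      & \forall x \near (0 : R)^'+, diagonaliser (sch_tildeA A s k x) (W x)].
Proof.
move=> VV0 uV0 diagV.
elim: k => [|k IHk] steps.
  have uM := scheme_step_unit (steps 0%N (leqnn _)).
  exists (fun x => invmx (sch_M s 0) *m V x), (invmx (sch_M s 0) *m V0).
  split; first exact: cvg_mulmx (cvg_cst _) VV0.
    by rewrite unitmx_mul unitmx_inv uM.
  by apply: filterS diagV => x; exact: diagonaliser_conj.
have [W [W0 [WW0 uW0 diagW]]] := IHk (fun j jk => steps j (leqW jk)).
have uM := scheme_step_unit (steps k.+1 (leqnn _)).
(* This is [sch_S s k] up to conversion, so conjugation by [S x] is exactly step k+1. *)
pose S := step_matrix cparam (sch_K s k) k (sch_M s k.+1).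
have cvgS : S @ (0 : R)^'+ --> sch_M s k.+1 
  by apply: cvg_step_matrix; exact: cvg_cparam.
exists (fun x => invmx (S x) *m W x), (invmx (sch_M s k.+1) *m W0).
split; first exact: cvg_mulmx (cvg_invmx cvgS uM) WW0.
  by rewrite unitmx_mul unitmx_inv uM.
apply: filterS2 (near_unitmx cvgS uM) diagW => x.
exact: diagonaliser_conj.
Qed.

End Run.

Lemma diagonaliser_diagonalizable (X V : 'M[C]_m) :
  diagonaliser X V -> diagonalizable X.
Proof.
move=> [uV dV]; exists (invmx V); first by rewrite unitmx_inv.
by rewrite /similar_to conjVmx.
Qed.

End Scheme.

(** * Validity of the assumption at every order *)

Unset Implicit Arguments.
Set Strict Implicit.
Set Printing Implicit Defensive.

Theorem lemma2p6 (R : realType) (m : nat)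
    (A : R -> 'M[Cplx R]_m) (a : nat -> 'M[Cplx R]_m)
    (contA : continuous A) (expA : has_expansion A a)
    (udA : exists2 eps : R, 0 < eps & uniformly_diagonable A `[0, eps[) :
  forall n : nat, assumptionA A a n.
Proof.
move=> n s k _ steps.
have [eps eps0 [V [contV diagV _]]] := udA.
have in_dom (x : R) : 0 <= x < eps -> `[0, eps[%classic x.
  by rewrite /= in_itv.
have dom0 : `[0, eps[%classic (0 : R) by apply: in_dom; rewrite lexx.
(* At order 0, continuity gives [a 0 = A 0], which the diagonaliser at the endpoint rho = 0 handles;
   later orders use the limit of transported diagonalisers. *)
case: k steps => [|k] steps.
  have <- : A 0 = sch_tildeL a s 0.
    apply/esym; apply: (leading_term_limit (expansion_negligible 0 expA)).
    exact: cvg_within_filter (contA 0).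
  exact: diagonaliser_diagonalizable (diagV 0 dom0).
have near_dom : \forall x \near (0 : R)^'+, `[0, eps[%classic x.
  apply: filterS2 (nbhs_right_gt 0) (nbhs_right_lt eps0) => x x0 xe.
  by apply: in_dom; rewrite ltW.
have VV0 : V @ (0 : R)^'+ --> V 0.
  (* Continuity within the half-open interval at its endpoint gives a right limit, since small
     positive points lie in the interval. *)
  have /subspace_continuousP/(_ 0 dom0) V_within := contV.
  apply: cvg_trans V_within; apply: cvg_app => P domP.
  have near_P : \forall x \near (0 : R)^'+, `[0, eps[%classic x -> P x.
    by apply: (cvg_within (F := nbhs (0 : R))); exact: domP.
  by apply: filterS2 near_dom near_P => x xdom; exact.
have [|W [W0 [WW0 uW0 diagW]]] :=
    scheme_diagonaliser (k := k) VV0 (proj1 (diagV 0 dom0)) _ steps.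
  exact: filterS diagV near_dom.
apply: (@diagonaliser_diagonalizable _ _ _ W0); split=> //.
rewrite /sch_tildeL /sch_block iter_bdiagE.
apply: (block_part_diagonalised cvg_cparam near_cparam_neq0 _ _ WW0 uW0 diagW).
  by move=> l lk; apply: scheme_step_diag (steps l lk).
exact: next_expansion (steps k (leqnn _)) (scheme_expansion expA steps).
Qed.
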